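(* For every integer $k \geq 4$, there is no diregular $(2,k,+3)$-digraph. That is, there is no finite digraph $G$ in which every vertex has in-degree and out-degree exactly $2$, which has exactly $1+2+2^2+\dots+2^k+3$ vertices, and which is $k$-geodetic.
   Context: A digraph $G$ is $k$-geodetic if for every ordered pair of (not necessarily distinct) vertices $x,y$ there is at most one directed path from $x$ to $y$ of length at most $k$; the trivial path of length $0$ from $x$ to $x$ counts, so in particular a $k$-geodetic digraph has no loops, no parallel arcs and no directed cycles of length at most $k$. For integers $d,k$ let $M(d,k)=1+d+d^2+\dots+d^k$ (the Moore bound). A $(d,k,+\epsilon)$-digraph is a $k$-geodetic digraph with minimum out-degree $d$ and order $M(d,k)+\epsilon$; it is diregular if every vertex has in-degree and out-degree exactly $d$. *)

(* Defs.v *)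
From mathcomp Require Import all_boot.
Set Implicit Arguments. Unset Strict Implicit. Unset Printing Implicit Defensive.

(* A (simple) digraph is given by a finite vertex type V and an arc relation
   e : rel V (no parallel arcs possible; loops are allowed by the type but are
   excluded by k-geodecity).  A directed path of length l from x to y is
   represented by the sequence p of its vertices after x: path e x p,
   last x p = y, size p = l.  The empty sequence is the trivial path. *)

Definition dpath (V : finType) (e : rel V) (x y : V) (p : seq V) : bool :=
  path e x p && (last x p == y).

Definition k_geodetic (V : finType) (e : rel V) (k : nat) : Prop :=
  forall (x y : V) (p q : seq V),
    dpath e x y p -> size p <= k ->
    dpath e x y q -> size q <= k -> p = q.

Definition outdeg (V : finType) (e : rel V) (x : V) : nat := #|[set y | e x y]|.
Definition indeg (V : finType) (e : rel V) (x : V) : nat := #|[set y | e y x]|.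

Definition diregular (V : finType) (e : rel V) (d : nat) : Prop :=
  forall x : V, outdeg e x = d /\ indeg e x = d.

Definition moore (d k : nat) : nat := \sum_(0 <= i < k.+1) d ^ i.

(* Main.v *)
Require Import Defs.
From mathcomp Require Import all_boot.
From mathcomp Require Import zify.
Set Implicit Arguments. Unset Strict Implicit. Unset Printing Implicit Defensive.

(* Let the excess be 2 or 3 and smaller than k, and let O(u) be the set of
   vertices at distance more than k from u. Suppose u -> a, c and v -> c, b with
   a <> b. The complement of the out-tree of c of depth k - 1 is
   {u} + T(a) + O(u) = {v} + T(b) + O(v), so the trees T(a) and T(b) differ in few
   vertices. A vertex at different depths in the two trees has descendants in only
   one of them, and their number doubles with each level, so the trees agree
   almost everywhere. First this forces b in O(u); then, descending along
   the unique branch on which the trees differ, either v is in O(u), or O(u) is the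
   interior of a path from v to u. The second in-neighbour v' of a excludes the
   path, so O(u) contains v, b, v' and the other out-neighbour a' of v'. Excess 2
   then gives a 2-cycle; excess 3 gives v = a' or v' = b, and propagating this
   equality to the neighbouring pairs yields two short paths with the same ends.

   Hence two vertices with a common out-neighbour have the same out-neighbours, and
   the digraph is a line digraph. For excess 2 this is impossible as the order is
   odd; for excess 3 the root digraph is (k-1)-geodetic with excess 2. *)

(** * Levels and truncated out-trees *)

Section Levels.
Variables (V : finType) (e : rel V).
Implicit Types (x y z : V) (s t h : nat).

Definition out x : {set V} := [set y | e x y].

Fixpoint lvl s x : {set V} :=
  if s is s'.+1 then \bigcup_(y in out x) lvl s' y else [set x].

Definition tree' h x : {set V} := [set y | [exists s : 'I_h, y \in lvl s.+1 x]].

Definition tree h x : {set V} := x |: tree' h x.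

Lemma lvl1 x : lvl 1 x = out x.
Proof.
apply/setP=> y; apply/bigcupP/idP => [[z Hz]|Hy]; first by rewrite inE => /eqP->.
by exists y => //; rewrite inE.
Qed.

Lemma lvlP s x y :
  reflect (exists2 p, dpath e x y p & size p = s) (y \in lvl s x).
Proof.
elim: s x => [|s IH] x /=.
  rewrite inE; apply: (iffP eqP) => [->|[p]].
    by exists [::]; rewrite // /dpath /= eqxx.
  by case: p => // /andP[_ /eqP].
apply: (iffP bigcupP) => [[z]|[[|z p]//]].
  rewrite inE => xz /IH[p /andP[zp lp] sp].
  by exists (z :: p); rewrite /dpath /= ?xz ?zp ?sp.
rewrite /dpath /= => /andP[/andP[xz zp] lp] [sp].
by exists z; [rewrite inE | apply/IH; exists p => //; apply/andP].
Qed.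

Lemma lvl_cat s t x y z : y \in lvl s x -> z \in lvl t y -> z \in lvl (s + t) x.
Proof.
elim: s x => [|s IH] x /=; first by rewrite inE => /eqP->.
case/bigcupP=> w xw wy yz; apply/bigcupP; exists w => //; exact: IH wy yz.
Qed.

Lemma lvl_split s t x z :
  z \in lvl (s + t) x -> exists2 y, y \in lvl s x & z \in lvl t y.
Proof.
elim: s x => [|s IH] x /=; first by move=> xz; exists x; rewrite ?inE.
case/bigcupP=> w xw /IH[y wy yz]; exists y => //; apply/bigcupP; by exists w.
Qed.

Lemma lvlS s x y z : y \in out x -> z \in lvl s y -> z \in lvl s.+1 x.
Proof. by move=> xy yz; apply/bigcupP; exists y. Qed.

Lemma lvlSr s x y z : y \in lvl s x -> z \in out y -> z \in lvl s.+1 x.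
Proof. by move=> xy; rewrite -lvl1 -(addn1 s) => yz; apply: lvl_cat xy yz. Qed.

Lemma lvl2 x y z : y \in out x -> z \in out y -> z \in lvl 2 x.
Proof. by rewrite -(lvl1 y); apply: lvlS. Qed.

Lemma tree'P h x y :
  reflect (exists s, [/\ 0 < s, s <= h & y \in lvl s x]) (y \in tree' h x).
Proof.
rewrite inE; apply: (iffP existsP) => [[s xy]|[[|s] [// _ sh xy]]].
  by exists s.+1.
by exists (Ordinal sh).
Qed.

Lemma treeP h x y :
  reflect (exists2 s, s <= h & y \in lvl s x) (y \in tree h x).
Proof.
rewrite in_setU1; apply: (iffP orP) => [[/eqP->|/tree'P[s [_ sh xy]]]|[[|s] sh xy]].
- by exists 0; rewrite //= inE.
- by exists s.
- by left; rewrite -in_set1.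
- by right; apply/tree'P; exists s.+1.
Qed.

Lemma tree'S h x y :
  (y \in tree' h.+1 x) = [exists z in out x, y \in tree h z].
Proof.
apply/tree'P/exists_inP => [[[|s] [// _ sh /bigcupP[z xz zy]]]|[z xz /treeP[s sh zy]]].
  by exists z => //; apply/treeP; exists s.
by exists s.+1; split=> //; apply: lvlS xz zy.
Qed.

Lemma tree'2 h x a c y : out x = [set a; c] ->
  (y \in tree' h.+1 x) = (y \in tree h a) || (y \in tree h c).
Proof.
move=> Nx; rewrite tree'S Nx; apply/exists_inP/orP.
  by case=> z; rewrite !inE => /orP[]/eqP-> ?; [left|right].
by case=> Hy; [exists a|exists c] => //; rewrite !inE eqxx ?orbT.
Qed.

Lemma tree'1 x : tree' 1 x = out x.
Proof.
apply/setP=> y; apply/tree'P/idP => [[s [s0 s1]]|xy].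
  by (have -> : s = 1 by lia); rewrite lvl1.
by exists 1; rewrite lvl1.
Qed.

End Levels.

(** * Geodetic digraphs of out-degree 2 *)

Section Geodetic.
Variables (V : finType) (e : rel V) (k : nat).
Hypothesis geo : k_geodetic e k.
Hypothesis deg : forall x, #|out e x| = 2.

Notation N := (out e).
Notation L := (lvl e).
Notation T := (tree e).
Notation T' := (tree' e).

Lemma lvl_inj s t x y : y \in L s x -> y \in L t x -> s <= k -> t <= k -> s = t.
Proof.
move=> /lvlP[p xp <-] /lvlP[q xq <-] sp sq; by rewrite (geo xp sp xq sq).
Qed.

Lemma lvl_mid s t x y y' z : y \in L s x -> y' \in L s x ->
  z \in L t y -> z \in L t y' -> s + t <= k -> y = y'.
Proof.
move=> /lvlP[p /andP[xp /eqP lp] <-] /lvlP[p' /andP[xp' /eqP lp'] sp'].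
move=> /lvlP[q /andP[yq /eqP lq] sq] /lvlP[q' /andP[yq' /eqP lq'] sq'] lek.
have: p ++ q = p' ++ q'.
  apply: (geo (x := x) (y := z)); rewrite /dpath ?size_cat ?cat_path ?last_cat.
  - by rewrite xp lp yq lq eqxx.
  - by rewrite sq.
  - by rewrite xp' lp' yq' lq' eqxx.
  - by rewrite sp' sq'.
by move/eqP; rewrite eqseq_cat ?sp' // => /andP[/eqP Ep _]; rewrite -lp -lp' Ep.
Qed.

Lemma acyclic s x : x \in L s x -> s <= k -> s = 0.
Proof. by move=> xx sk; apply: (lvl_inj xx) => //=; rewrite inE. Qed.

Lemma out2 x : exists a c, N x = [set a; c] /\ a != c.
Proof.
have /eqP/cards2P[a [c] [ac Nx]] := deg x; by exists a, c.
Qed.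

Lemma outD x a c : N x = [set a; c] -> a != c.
Proof. by move=> Nx; have := deg x; rewrite Nx cards2; case: eqP. Qed.

Lemma out_other x c : c \in N x -> exists2 a, N x = [set a; c] & a != c.
Proof.
have [a [b [Nx ab]]] := out2 x.
rewrite Nx !inE => /orP[]/eqP->; last by exists a.
by exists b; [rewrite setUC|rewrite eq_sym].
Qed.

Lemma card_lvl s x : s <= k -> #|L s x| = 2 ^ s.
Proof.
elim: s x => [|s IH] x sk; first by rewrite /= cards1.
have [a [c [Nx ac]]] := out2 x.
have xa : a \in L 1 x by rewrite lvl1 Nx !inE eqxx.
have xc : c \in L 1 x by rewrite lvl1 Nx !inE eqxx orbT.
have -> : L s.+1 x = L s a :|: L s c.
  by rewrite /= Nx bigcup_setU !big_set1.
rewrite cardsU disjoint_setI0 ?cards0 ?IH; [|lia|lia|].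
  by rewrite expnS; lia.
rewrite disjoints_subset; apply/subsetP=> z az; rewrite inE; apply/negP=> cz.
by move/eqP: ac; apply; apply: (lvl_mid xa xc az cz).
Qed.

Lemma lvl_nonempty s x : s <= k -> exists y, y \in L s x.
Proof.
move=> sk; apply/set0Pn; rewrite -card_gt0 card_lvl ?expn_gt0 //.
Qed.

Lemma card_tree h x : h <= k -> (#|T h x|).+1 = 2 ^ h.+1.
Proof.
elim: h => [|h IH] hk.
  suff -> : T 0 x = [set x] by rewrite cards1.
  apply/setP=> y; rewrite inE; apply/treeP/eqP => [[s]|->].
    by rewrite leqn0 => /eqP->; rewrite inE => /eqP.
  by exists 0; rewrite //= inE.
have -> : T h.+1 x = T h x :|: L h.+1 x.
  apply/setP=> y; rewrite in_setU; apply/treeP/orP.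
    case=> s; rewrite leq_eqVlt => /orP[/eqP->|]; first by right.
    by left; apply/treeP; exists s.
  by case=> [/treeP[s sh xy]|xy]; [exists s|exists h.+1] => //; lia.
rewrite cardsU disjoint_setI0 ?cards0 ?card_lvl ?subn0 //.
  by rewrite -addSn IH ?(ltnW hk) // [2 ^ h.+2]expnS; lia.
rewrite disjoints_subset; apply/subsetP=> z /treeP[s sh xz].
rewrite inE; apply/negP=> xz'.
have := lvl_inj xz xz' _ hk; lia.
Qed.

Lemma tree_disj h x a c z : a \in N x -> c \in N x -> a != c -> h < k ->
  z \in T h a -> z \in T h c -> False.
Proof.
move=> xa xc ac hk /treeP[s sh az] /treeP[t th cz].
have st : s.+1 = t.+1.
  by apply: (lvl_inj (lvlS xa az) (lvlS xc cz)); lia.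
move/eqP: ac; apply; rewrite -!lvl1 in xa xc.
move: st => [st]; rewrite -st in cz; apply: (lvl_mid xa xc az cz); lia.
Qed.

(* The [2 ^ (h.+1 - s)] descendants of [z] lying at depth [h.+1] below [y] are
   outside the tree of [y], but still inside that of [x], where [z] is higher. *)
Lemma lvl_mismatch h s t x y z w : z \in L t x -> z \in L s y -> t < s -> s <= h ->
  h < k -> w \in L (h.+1 - s) z -> w \in L (t + (h.+1 - s)) x /\ w \notin T h y.
Proof.
move=> xz yz ts sh hk zw; split; first exact: lvl_cat xz zw.
apply/negP=> /treeP[r rh yw].
have := lvl_inj (lvl_cat yz zw) yw; lia.
Qed.

(** If an out-neighbour [x] of [a] had [R] inside [N x], the other one, [y], would lie in [R], hence
    at depths 1 and 2 below [a], or would share the elements of [R] with [x] as out-neighbours.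
    Geodecity excludes both. *)
Lemma out_chain a (R : {set V}) : 1 < k -> R != set0 ->
  (forall x, x \in N a -> (x \in R) || (R \subset N x)) -> N a \subset R.
Proof.
move=> k2 /set0Pn[w wR] H.
have [b [c [Na bc]]] := out2 a.
have key x y : x \in N a -> y \in N a -> x != y -> R \subset N x -> False.
  move=> ax ay xy /subsetP sx.
  have /orP[yR|/subsetP sy] := H y ay.
    have := lvl_inj (lvl2 ax (sx _ yR)) (_ : y \in L 1 a).
    by rewrite lvl1 => /(_ ay k2 (ltnW k2)).
  have := sx _ wR; have := sy _ wR; rewrite -!lvl1 => yw xw.
  by move/eqP: xy; apply; rewrite -!lvl1 in ax ay; apply: (lvl_mid ax ay xw yw).
have ab : b \in N a by rewrite Na !inE eqxx.
have ac : c \in N a by rewrite Na !inE eqxx orbT.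
apply/subsetP=> x ax; have /orP[//|sx] := H x ax.
exfalso; move: (ax); rewrite Na !inE => /orP[]/eqP xe; rewrite xe in sx.
  exact: key ab ac bc sx.
by apply: key ac ab _ sx; rewrite eq_sym.
Qed.

End Geodetic.

(* [lia] translates every boolean hypothesis, membership facts included, at a
   prohibitive cost; the latter are irrelevant and dropped beforehand. *)
Ltac arith :=
  repeat match goal with
  | H : ?P |- _ =>
    lazymatch type of P with
    | Prop =>
      lazymatch P with
      | is_true (leq _ _) => fail
      | @eq nat _ _ => fail
      | _ => clear H
      end
    end
  end; lia.

(** * Pairs sharing exactly one out-neighbour, at excess 2 or 3 *)

Section Excess.
Variables (V : finType) (e : rel V) (K ep : nat).
Hypothesis geo : k_geodetic e K.+1.
Hypothesis deg : forall x, #|out e x| = 2.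
Hypothesis ideg : forall x, #|[set y | e y x]| = 2.
Hypothesis cardV : #|V|.+1 = 2 ^ K.+2 + ep.
Hypothesis ep2 : 1 < ep.
Hypothesis ep3 : ep <= 3.
Hypothesis epK : ep <= K.

Notation N := (out e).
Notation L := (lvl e).
Notation T := (tree e).
Notation T' := (tree' e).

Definition outliers x := ~: T K.+1 x.
Notation O := outliers.

Definition sharing u v a c b := [/\ N u = [set a; c], N v = [set c; b] & a != b].

Lemma sharing_sym u v a c b : sharing u v a c b -> sharing v u b c a.
Proof. by case=> Nu Nv ab; split; rewrite 1?eq_sym // setUC. Qed.

Lemma sharingE u v a c b : sharing u v a c b ->
  [/\ a \in N u, c \in N u, c \in N v & b \in N v] /\ [/\ a != c, c != b, a != b & u != v].
Proof.
case=> Nu Nv ab; split; first by rewrite Nu Nv !inE !eqxx !orbT.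
split=> //; [exact: outD Nu|exact: outD Nv|].
apply/eqP=> uv; have ac := outD deg Nu.
have: a \in N v by rewrite -uv Nu !inE eqxx.
by rewrite Nv !inE (negbTE ac) (negbTE ab).
Qed.

Lemma card_outliers x : #|O x| = ep.
Proof.
have := cardsC (T K.+1 x); have := card_tree geo deg x (leqnn K.+1).
by rewrite -/(O x); move: cardV; arith.
Qed.

Lemma outlier_lvl x z s : z \in O x -> z \in L s x -> s <= K.+1 -> False.
Proof. by rewrite inE => /negP H xz sk; apply: H; apply/treeP; exists s. Qed.

Lemma outliersN x z : z \notin O x -> exists2 s, s <= K.+1 & z \in L s x.
Proof. by rewrite inE negbK => /treeP. Qed.

Lemma tree_outlier x y z h : y \in N x -> z \in T h y -> h <= K -> z \in O x -> False.
Proof.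
move=> xy /treeP[s sh yz] hK xz.
by apply: (outlier_lvl xz (lvlS xy yz)); arith.
Qed.

(** [v], [O v] and the trees of [b] and [c] cover all vertices, and the tree of [c] is disjoint from
    that of its sibling [a]. *)
Lemma tree_sharing u v a c b z : sharing u v a c b -> z \in T K a ->
  [|| z == v, z \in T K b | z \in O v].
Proof.
move=> sh az; have [[ua uc _ _] [ac _ _ _]] := sharingE sh; have [_ Nv _] := sh.
rewrite in_setC [z \in T K.+1 v]in_setU1 (tree'2 _ _ Nv).
have -> : (z \in T K c) = false.
  by apply/negP=> cz; apply: (tree_disj geo ua uc ac _ az cz).
by case: (z == v); case: (z \in T K b).
Qed.

(** A shorter route from [b] to [u], continued by the arc to [c], would give [v] a second short path
    to [c]. *)
Lemma lvl_sharing_far u v a c b j : sharing u v a c b -> u \in L j b -> K <= j.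
Proof.
move=> sh bu; have [[ua uc vc vb] _] := sharingE sh.
rewrite leqNgt; apply/negP=> jK; rewrite -lvl1 in vc.
have := lvl_inj geo vc (lvlS vb (lvlSr bu uc)); arith.
Qed.

(** A [b] within reach of [u] lies below [a], and its descendants one level beyond the tree of [a]
    must be in [u |: O u]. As these are few, [b] is a leaf of that tree. A [v] within reach would
    then put [b] at depth [K.+1] below [a] as well. *)
Lemma not_outlier_sharing u v a c b : sharing u v a c b -> b \notin O u ->
  [/\ b \in L K a, N b \subset O u & v \in O u].
Proof.
move=> sh /outliersN[[|t] tk ub].
  move: ub; rewrite inE => /eqP bu.
  by have := lvl_sharing_far (j := 0) sh; rewrite /= inE bu eqxx; arith.
have [[ua uc vc vb] [ac cb ab uv]] := sharingE sh; have [Nu Nv _] := sh.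
have {}ub : b \in L t a.
  move: ub => /= /bigcupP[y]; rewrite Nu !inE => /orP[]/eqP-> // cb'.
  rewrite -lvl1 in vb.
  have t0 : t = 0 by have := lvl_inj geo vb (lvlS vc cb'); arith.
  by move: cb'; rewrite t0 inE eq_sym (negbTE cb).
case: t tk ub => [|s] tk ub.
  by move: ub; rewrite inE [b == a]eq_sym (negbTE ab).
have key w : w \in L (K.+1 - s.+1) b -> w \in u |: O u.
  move=> bw; have bT : w \in T K b by apply/treeP; exists (K.+1 - s.+1) => //; arith.
  have /or3P[/eqP->|/treeP[r rK aw]|wO] := tree_sharing (sharing_sym sh) bT.
  - by rewrite !inE eqxx.
  - have := lvl_inj geo (lvl_cat ub bw) aw; arith.
  - by rewrite in_setU1 wO orbT.
have cl := card_lvl geo deg b (leq_subr s.+1 K.+1).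
have Es : s.+1 = K.
  (* For [s = 0] the descendants number [2 ^ K], at least [2 ^ ep] and so more than [ep + 1].
     Otherwise [u] is too far below [b] to be one of them, and at most [ep] remain. *)
  case: (posnP s) => [s0|s0].
    have /subset_leq_card : L (K.+1 - s.+1) b \subset u |: O u by apply/subsetP.
    rewrite cl cardsU1 card_outliers s0 subn1 /=.
    suff : ep + 1 < 2 ^ K by arith.
    have : 2 ^ ep <= 2 ^ K by rewrite leq_exp2l.
    by case: (ep) ep2 ep3 => [|[|[|[|?]]]] //=; arith.
  have /subset_leq_card : L (K.+1 - s.+1) b \subset O u.
    apply/subsetP=> w bw; have := key w bw; rewrite in_setU1 => /orP[/eqP wu|//].
    by rewrite wu in bw; have := lvl_sharing_far sh bw; arith.
  rewrite cl card_outliers => le3.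
  have : K.+1 - s.+1 < 2 by rewrite -(ltn_exp2l _ _ (ltnSn 1)); arith.
  arith.
rewrite Es in ub tk key; split=> //.
  apply/subsetP=> w bw; have := key w; rewrite subSnn lvl1 in_setU1 => /(_ bw).
  case/orP=> // /eqP wu; rewrite wu -lvl1 in bw.
  by have := lvl_sharing_far sh bw; arith.
apply/negPn/negP=> /outliersN[[|r] rk uv'].
  by move: uv'; rewrite inE eq_sym (negbTE uv).
have: (v \in T K a) || (v \in T K c).
  by rewrite -(tree'2 _ _ Nu); apply/tree'P; exists r.+1.
case/orP=> /treeP[r' r'K av].
  have := lvl_sharing_far (sharing_sym sh) av.
  have := lvl_inj geo (lvlSr av vb) ub; arith.
by have := acyclic geo (lvlS vc av); arith.
Qed.

(* Otherwise O(u) = {v} + N(b) and the trees of a and b agree from depth 2 on,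
   although b itself is a leaf of the tree of a. *)
Lemma sharing_outlier u v a c b : sharing u v a c b -> b \in O u.
Proof.
move=> sh; apply/negPn/negP=> bO.
have [ab Nb vO] := not_outlier_sharing sh bO.
have [[ua uc vc vb] [ac cb nab uv]] := sharingE sh; have [Nu Nv _] := sh.
have vNb : v \notin N b.
  by apply/negP=> bv; have := acyclic geo (lvl2 vb bv); arith.
have ep_eq : ep = 3.
  have /subset_leq_card : v |: N b \subset O u by rewrite subUset sub1set vO.
  by rewrite cardsU1 vNb deg card_outliers; arith.
have K1 : 0 < K by arith.
have aT z s : z \in L s a -> s <= K -> [|| z \in T K b | z \in O v].
  move=> az sK; have zT : z \in T K a by apply/treeP; exists s.
  case/or3P: (tree_sharing sh zT) => [/eqP zv|->//|->]; last by rewrite orbT.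
  by rewrite zv in zT; case: (tree_outlier ua zT (leqnn K) vO).
(* Either [a] is not in [O v] and the mirrored lemma identifies [O v] as [u |: N a], or the two
   elements of [O v :\ a] turn out to be [N a]. *)
have Ov z : z \in O v -> [|| z == u, z == a | z \in N a].
  case: (boolP (a \in O v)) => [aO|aO]; last first.
    have [_ Na uO] := not_outlier_sharing (sharing_sym sh) aO.
    have uNa : u \notin N a.
      by apply/negP=> au; have := acyclic geo (lvl2 ua au); arith.
    have /eqP<- : u |: N a == O v.
      by rewrite eqEcard subUset sub1set uO Na cardsU1 uNa deg card_outliers ep_eq.
    by rewrite in_setU1 => /orP[->//|->]; rewrite !orbT.
  have cR : #|O v :\ a| = 2 by have := cardsD1 a (O v); rewrite aO card_outliers; arith.
  have sR : N a \subset O v :\ a.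
    apply: (out_chain geo deg); [arith|by rewrite -card_gt0 cR|].
    move=> x ax; have ax1 := ax; rewrite -lvl1 in ax1.
    have xa : x != a.
      by apply/eqP=> xa; rewrite xa in ax1; have := acyclic geo ax1; arith.
    case/orP: (aT _ _ ax1 K1) => [|xO]; last first.
      by rewrite in_setD1 xa xO.
    move/treeP=> [s sK bx].
    have s2 : 1 < s.
      case: s sK bx => [|[|s]] // sK.
        by rewrite inE => /eqP xb; rewrite xb in ax1; have := lvl_inj geo ax1 ab; arith.
      rewrite lvl1 => /(subsetP Nb) xO.
      by case: (outlier_lvl xO (lvlS ua ax1)); arith.
    have sub : L (K.+1 - s) x \subset O v :\ a.
      apply/subsetP=> w xw.
      have [aw wT] := lvl_mismatch geo ax1 bx s2 sK (ltnSn K) xw.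
      have := aT _ _ aw; rewrite (negbTE wT) /= in_setD1 => -> ; last arith.
      rewrite andbT; apply/eqP=> wa; rewrite wa in aw.
      by have := acyclic geo aw; arith.
    have := subset_leq_card sub; rewrite (card_lvl geo deg) ?leq_subr // cR => le2.
    have Es : K.+1 - s = 1.
      case E : (K.+1 - s) => [|[|r]] //; first arith.
      by move: le2; rewrite E !expnS; have := expn_gt0 2 r; arith.
    rewrite Es lvl1 in sub; apply/orP; right.
    suff /eqP-> : N x == O v :\ a by [].
    by rewrite eqEcard sub cR deg.
  have /eqP Na : N a == O v :\ a by rewrite eqEcard sR cR deg.
  by move=> zO; rewrite Na in_setD1 zO andbT; case: (z == a); rewrite ?orbT.
have Ov_lvl z s : z \in O v -> z \in L s a -> 1 < s -> s <= K -> False.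
  move=> /Ov/or3P[/eqP->|/eqP->|Na] az s1 sK.
  - by have := acyclic geo (lvlS ua az); arith.
  - by have := acyclic geo az; arith.
  - by rewrite -lvl1 in Na; have := lvl_inj geo Na az; arith.
have K3 : 2 < K by arith.
have sub2 z : z \in L 2 a -> z \in L 2 b.
  move=> az; case/orP: (aT _ _ az (ltnW K3)) => [|zO]; last first.
    by case: (Ov_lvl _ _ zO az) => //; arith.
  case/treeP=> [[|[|[|s]]]] sK bz //.
  - move: bz; rewrite inE => /eqP zb; rewrite zb in az.
    by have := lvl_inj geo az ab; arith.
  - move: bz; rewrite lvl1 => /(subsetP Nb) zO.
    by case: (outlier_lvl zO (lvlS ua az)); arith.
  have [|w zw] := lvl_nonempty geo deg (s := K.+1 - s.+3) z; first arith.
  have [|aw wT] := lvl_mismatch geo az bz _ sK (ltnSn K) zw; first arith.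
  have := aT _ _ aw; rewrite (negbTE wT) /= => wO.
  by case: (Ov_lvl _ _ (wO _) aw); arith.
(* The path of length [K] from [a] to [b] passes at depth 2 through a vertex that is also below [b],
   which closes a cycle. *)
have {}ab : b \in L (2 + (K - 2)) a by rewrite subnKC //; arith.
have [y /sub2 by_ yb] := lvl_split ab.
have := acyclic geo (lvl_cat by_ yb); arith.
Qed.

(* In disjoint unions, {p} + T'(a) + B = {q} + T'(a') + B', where T' is the tree
   of depth [h] without its root and p, q occur in T'(a'), T'(a) only as leaves. *)
Definition balanced h a a' p q (B B' : {set V}) :=
  [/\ p |: (T' h a :|: B) = q |: (T' h a' :|: B'),
      p \notin T' h a /\ q \notin T' h a',
      [disjoint B & T' h a] /\ [disjoint B' & T' h a'],
      forall j, q \in L j a -> h <= j &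
      forall j, p \in L j a' -> h <= j].

Lemma balanced_sym h a a' p q B B' :
  balanced h a a' p q B B' -> balanced h a' a q p B' B.
Proof. by case=> E [? ?] [? ?] ? ?; split. Qed.

Lemma balanced_mem h a a' p q B B' z : balanced h a a' p q B B' ->
  z \in T' h a -> [|| z == q, z \in T' h a' | z \in B'].
Proof.
case=> E _ _ _ _ az; have : z \in p |: (T' h a :|: B).
  by rewrite in_setU1 in_setU az orbT.
by rewrite E in_setU1 in_setU.
Qed.

(** If [x] occurs in the tree of [a'], it is at depth at least 2 there, and its descendants just
    beyond that tree are still in the tree of [a], hence in [q |: B']. At most three vertices leave
    room for a single doubling, so these descendants are [N x]. *)
Lemma balanced_child h a a' p q B B' x : balanced h a a' p q B B' ->
  1 < h -> h <= K -> #|B'| <= 2 -> x \in N a -> x \notin N a' ->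
  (x \in B') || (N x \subset q |: B').
Proof.
move=> bal h1 hK cB ax nx; have [_ _ _ far _] := bal.
have ax1 := ax; rewrite -lvl1 in ax1.
have xT : x \in T' h a by apply/tree'P; exists 1; split=> //; arith.
case/or3P: (balanced_mem bal xT) => [/eqP xq|/tree'P[s [s0 sh a'x]]|->//].
  by rewrite xq in ax1; have := far _ ax1; arith.
have s1 : 1 < s.
  by case: s s0 a'x {sh} => [|[|s]] //; rewrite lvl1 (negbTE nx).
have sub : L (h.+1 - s) x \subset q |: B'.
  apply/subsetP=> w xw; have [aw wT] := lvl_mismatch geo ax1 a'x s1 sh hK xw.
  have wT' : w \in T' h a by apply/tree'P; exists (1 + (h.+1 - s)); split=> //; arith.
  rewrite in_setU1; case/or3P: (balanced_mem bal wT') => [->//|wT2|->].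
    by case/negP: wT; rewrite in_setU1 wT2 orbT.
  by rewrite orbT.
have := subset_leq_card sub; rewrite (card_lvl geo deg); last by arith.
rewrite cardsU1 => le3; have Es : h.+1 - s = 1.
  have : h.+1 - s < 2 by rewrite -(ltn_exp2l _ _ (ltnSn 1)); case: (q \notin B') le3; arith.
  by arith.
by rewrite Es lvl1 in sub; rewrite sub orbT.
Qed.

(** A vertex at depth 2 below [a] is neither [q] nor in [B' = N a], so it lies below [a']. Depth 1
    is excluded there because [N a' = B] misses the tree of [a]; at depth 3 or more, at least two
    descendants would have to equal [q]. *)
Lemma balanced_lvl2 h a a' p q B B' : balanced h a a' p q B B' ->
  2 < h -> h <= K -> N a = B' -> N a' = B -> L 2 a \subset L 2 a'.
Proof.
move=> bal h2 hK Na Na'; have [_ _ [dB _] far _] := bal.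
apply/subsetP=> z az.
have zT : z \in T' h a by apply/tree'P; exists 2; split=> //; arith.
have N1 y j : y \in B' -> y \in L j a -> 1 < j -> j <= h -> False.
  by rewrite -Na -lvl1 => ay ay' j1 jh; have := lvl_inj geo ay ay'; arith.
case/or3P: (balanced_mem bal zT) => [/eqP zq|/tree'P[s [s0 sh a'z]]|zB].
- by rewrite zq in az; have := far _ az; arith.
- case: s s0 sh a'z => [|[|[|s]]] // _ sh a'z.
    rewrite lvl1 Na' in a'z.
    by have := disjointFr dB a'z; rewrite zT.
  have sub : L (h.+1 - s.+3) z \subset [set q].
    apply/subsetP=> w zw; have [aw wT] := lvl_mismatch geo az a'z (ltn0Sn s : 2 < s.+3) sh hK zw.
    have wT' : w \in T' h a.
      by apply/tree'P; exists (2 + (h.+1 - s.+3)); split=> //; arith.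
    case/or3P: (balanced_mem bal wT') => [wq|wT2|wB]; rewrite ?inE //.
      by case/negP: wT; rewrite in_setU1 wT2 orbT.
    by case: (N1 _ _ wB aw); arith.
  have := subset_leq_card sub; rewrite (card_lvl geo deg) ?cards1; last by arith.
  have : 2 ^ 1 <= 2 ^ (h.+1 - s.+3) by rewrite leq_exp2l //; arith.
  by arith.
- by case: (N1 _ _ zB az); arith.
Qed.

(** For [h > 1], disjoint out-sets would force [N a = B'] and [N a' = B], so that [L 2 a'] is inside
    [L 2 a]. Then [p] has no place on the right of the balance: in [B'] or in the tree of [a'] it
    would also be in the tree of [a]. *)
Lemma balanced_meet h a a' p q B B' : balanced h a a' p q B B' -> p != q ->
  #|B| = #|B'| -> #|B| <= 2 -> #|B| < h -> h <= K -> N a :&: N a' != set0.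
Proof.
move=> bal pq cBB cB cBh hK; apply/negP=> /eqP dN.
have nN x : x \in N a -> x \notin N a'.
  by move=> ax; apply/negP=> a'x; have : x \in N a :&: N a' by [rewrite inE ax];
     rewrite dN inE.
have nN' x : x \in N a' -> x \notin N a.
  by move=> ax; apply/negP=> /nN; rewrite ax.
have [_ [pT qT] [dB dB'] far far'] := bal.
have K1 : 1 < K.+1 by arith.
have h0 : 0 < h by arith.
case: (leqP h 1) => [h1|h1].
  have Eh : h = 1 by arith.
  have B0 : B' = set0 by apply/eqP; rewrite -cards_eq0; apply/eqP; arith.
  have : N a \subset [set q].
    apply/subsetP=> x ax; have := balanced_mem (z := x) bal.
    rewrite Eh !tree'1 ax B0 (negbTE (nN _ ax)) in_set0 in_set1 !orbF.
    exact.
  by move/subset_leq_card; rewrite deg cards1.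
have chain (b b' r r' : V) (C C' : {set V}) : balanced h b b' r r' C C' ->
    #|C'| = #|B'| -> (forall x, x \in N b -> x \notin N b') -> N b = C' /\ #|B'| = 2.
  move=> bal' cC nNb; have [_ _ _ farb _] := bal'.
  have cC2 : #|C'| <= 2 by arith.
  have C0 : C' != set0.
    apply/negP=> /eqP C0; have [x [y [Nb xy]]] := out2 deg b.
    have bx : x \in N b by rewrite Nb !inE eqxx.
    have := balanced_child bal' h1 hK cC2 bx (nNb _ bx).
    by rewrite C0 inE setU0 => /subset_leq_card; rewrite deg cards1.
  have sub : N b \subset C'.
    apply: (out_chain geo deg) => // x bx.
    have /orP[->//|sx] := balanced_child bal' h1 hK cC2 bx (nNb _ bx).
    apply/orP; right; have cC0 : 0 < #|C'| by rewrite card_gt0.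
    (* By depth, [r'] can be in [N x] only when [h = 2]; then [C'] has one element and [N x] fills
       [r' |: C']. *)
    case: (boolP (r' \in N x)) => rx.
      have /eqP-> : N x == r' |: C'; last exact: subsetUr.
      rewrite eqEcard sx deg cardsU1.
      have := farb _ (lvl2 bx rx) => h2.
      by case: (r' \in C') => /=; arith.
    have sx' : N x \subset C'.
      apply/subsetP=> y xy; have := subsetP sx _ xy; rewrite in_setU1 => /orP[/eqP yr|//].
      by rewrite -yr xy in rx.
    by have /eqP-> : N x == C' by rewrite eqEcard sx' deg.
  have := subset_leq_card sub; rewrite deg => c2.
  split; last by arith.
  by apply/eqP; rewrite eqEcard sub deg.
have [Na cB'2] := chain _ _ _ _ _ _ bal (erefl _) nN.
have [Na' _] := chain _ _ _ _ _ _ (balanced_sym bal) cBB nN'.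
have h3 : 2 < h by arith.
have sub2 := balanced_lvl2 (balanced_sym bal) h3 hK Na' Na.
have [E _ _ _ _] := bal.
have : p \in p |: (T' h a :|: B) by rewrite in_setU1 eqxx.
rewrite E in_setU1 (negbTE pq) in_setU /= => /orP[/tree'P[s [s0 sh a'p]]|pB].
  have := far' _ a'p => hs; have Es : s = 2 + (h - 2) by arith.
  rewrite Es in a'p; have [y /(subsetP sub2) ay yp] := lvl_split a'p.
  case/negP: pT; apply/tree'P; exists s; rewrite s0 sh Es; split=> //.
  exact: lvl_cat ay yp.
case/negP: pT; apply/tree'P; exists 1; split=> //.
by rewrite lvl1 Na.
Qed.

(** Removing the common subtree of [c] and the vertices [b] and [b'] from both sides leaves a
    balance one level lower. *)
Lemma balanced_step h a a' b c b' p q B B' : balanced h.+1 a a' p q B B' ->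
  0 < h -> h < K -> sharing a a' b c b' -> b \in B' -> b' \in B ->
  balanced h b b' p q (B :\ b') (B' :\ b).
Proof.
have half (a0 a1 b0 b1 p0 q0 : V) (C C' : {set V}) z : balanced h.+1 a0 a1 p0 q0 C C' ->
    0 < h -> h < K -> sharing a0 a1 b0 c b1 -> b1 \in C ->
    (z \in p0 |: (T' h b0 :|: (C :\ b1)))
      = [&& z \in p0 |: (T' h.+1 a0 :|: C), z \notin T h c, z != b0 & z != b1].
  move=> bal h0 hK sh b1C; have [_ [pT _] [dC _] _ far'] := bal.
  have [[ab0 ac _ a1b1] [bc _ nbb _]] := sharingE sh; have [Na _ _] := sh.
  rewrite [z \in p0 |: (T' h b0 :|: _)]in_setU1 [z \in p0 |: (T' h.+1 a0 :|: _)]in_setU1.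
  rewrite [z \in T' h b0 :|: _]in_setU [z \in T' h.+1 a0 :|: _]in_setU in_setD1.
  case: (altP (z =P p0)) => [->|zp] /=.
    rewrite (tree'2 _ _ Na) negb_or [p0 \in T h b0]in_setU1 negb_or in pT.
    case/andP: pT => /andP[-> _] -> /=; apply/esym/eqP=> pb.
    by rewrite -pb -lvl1 in a1b1; have := far' _ a1b1; arith.
  rewrite (tree'2 _ _ Na) [z \in T h b0]in_setU1.
  case: (altP (z =P b0)) => [->|zb0] /=.
    have bT : b0 \in T' h.+1 a0 by apply/tree'P; exists 1; rewrite lvl1.
    rewrite [b0 \in C](disjointFl dC) // andbF orbF andbF.
    apply/negP=> /tree'P[s [s0 sh' bb]].
    by have := acyclic geo bb; arith.
  case: (boolP (z \in T' h b0)) => zb /=.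
    have zT : z \in T h b0 by rewrite in_setU1 zb orbT.
    have -> : z \notin T h c.
      by apply/negP=> cz; apply: (tree_disj geo ab0 ac bc _ zT cz); arith.
    have zT' : z \in T' h.+1 a0 by rewrite (tree'2 _ _ Na) zT.
    apply/esym/eqP=> zb1; rewrite zb1 in zT'.
    by have := disjointFr dC b1C; rewrite zT'.
  case: (boolP (z \in T h c)) => cz /=; last by rewrite andbC.
  rewrite [z \in C](disjointFl dC) ?andbF //.
  by rewrite (tree'2 _ _ Na) cz orbT.
move=> bal h0 hK sh bB b'B.
have [E [pT qT] [dB dB'] far far'] := bal.
have [[ab ac a'c a'b'] _] := sharingE sh.
have sT (a0 b0 : V) : b0 \in N a0 -> T' h b0 \subset T' h.+1 a0.
  move=> ab0; apply/subsetP=> z /tree'P[s [s0 sh' bz]].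
  by apply/tree'P; exists s.+1; split=> //; apply: lvlS ab0 bz.
split.
- apply/setP=> z; rewrite (half _ _ _ _ _ _ _ _ _ bal h0 hK sh b'B).
  rewrite (half _ _ _ _ _ _ _ _ _ (balanced_sym bal) h0 hK (sharing_sym sh) bB) E.
  by rewrite [(z != b) && _]andbC.
- by split; [move: pT|move: qT]; apply: contra; apply: subsetP; apply: sT.
- split.
    apply: disjointWl (subD1set _ _) _; apply: disjointWr (sT _ _ ab) dB.
  apply: disjointWl (subD1set _ _) _; exact: disjointWr (sT _ _ a'b') dB'.
- by move=> j bq; have := far _ (lvlS ab bq).
- by move=> j bq; have := far' _ (lvlS a'b' bq).
Qed.

(** Induction on the number of exceptional vertices. By [balanced_meet] the roots share an
    out-neighbour. Equal out-sets leave only [B] and [B'] for [q] and [p]; otherwise the remaining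
    out-neighbours are exceptional, and removing them descends one level. The vertices [b'] removed
    from [B] form the path. *)
Lemma descent beta h a a' p q B B' : balanced h a a' p q B B' -> p != q ->
  #|B| = beta -> #|B'| = beta -> beta <= 2 -> beta < h -> h <= K ->
  q \in B /\ p \in B' \/ h = beta.+1 /\
  exists s, [/\ path e a' s, size s = beta, e (last a' s) p & B =i s].
Proof.
elim: beta h a a' B B' => [|beta IH] h a a' B B' bal pq cB cB' b2 bh hK;
  have [E [pT qT] _ far far'] := bal;
  have /set0Pn[c] : N a :&: N a' != set0
    by [apply: (balanced_meet bal) => //; rewrite ?cB ?cB'];
  rewrite in_setI => /andP[ac a'c];
  have [b Na bc] := out_other deg ac; have [b' Na' b'c] := out_other deg a'c;
  case: (altP (b =P b')) => [bb|bb].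
1,3: have ET : T' h a = T' h a' by
  case: (h) bh => // h' _; apply/setP=> z; rewrite !tree'S Na Na' bb.
1,2: left; split;
  [have : q \in p |: (T' h a :|: B) by [rewrite E in_setU1 eqxx];
   rewrite in_setU1 in_setU ET (negbTE qT) eq_sym (negbTE pq)
  |have : p \in q |: (T' h a' :|: B') by [rewrite -E in_setU1 eqxx];
   rewrite in_setU1 in_setU -ET (negbTE pT) (negbTE pq)]; by [].
(* Being an outlier of [a], [b'] can only be [p] or in [B]; likewise [b] is [q] or in [B']. *)
all: have sh : sharing a a' b c b' by [split=> //; rewrite setUC];
  have [[ab _ _ a'b'] _] := sharingE sh;
  have b'O := sharing_outlier sh; have bO := sharing_outlier (sharing_sym sh);
  have nT (x y : V) : y \in O x -> y \notin T' h x
    by [move=> yO; apply/negP=> /tree'P[s [_ sh' xy]]; apply: (outlier_lvl yO xy); arith];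
  have bT : b \in T' h a by [apply/tree'P; exists 1; rewrite lvl1; split=> //; arith];
  have b'T : b' \in T' h a' by [apply/tree'P; exists 1; rewrite lvl1; split=> //; arith];
  have := balanced_mem bal bT; have := balanced_mem (balanced_sym bal) b'T;
  rewrite (negbTE (nT _ _ bO)) (negbTE (nT _ _ b'O)) /=.
- have -> : B = set0 by apply/eqP; rewrite -cards_eq0 cB.
  have -> : B' = set0 by apply/eqP; rewrite -cards_eq0 cB'.
  rewrite !inE !orbF => /eqP b'p /eqP bq; right; split.
    by rewrite bq -lvl1 in ab; have := far _ ab; arith.
  by exists [::]; split=> // [|x]; rewrite ?inE //= -b'p; rewrite inE in a'b'.
- rewrite -lvl1 in ab; rewrite -lvl1 in a'b'.
  have -> : b == q = false by apply/eqP=> bq; rewrite bq in ab; have := far _ ab; arith.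
  have -> : b' == p = false by apply/eqP=> bq; rewrite bq in a'b'; have := far' _ a'b'; arith.
  move=> /= b'B bB'.
  case: h bh hK bal {E pT qT far far' nT bT b'T} => // h bh hK bal.
  have := balanced_step bal _ hK sh bB' b'B => bal'.
  have c1 : #|B :\ b'| = beta by have := cardsD1 b' B; rewrite b'B cB; arith.
  have c2 : #|B' :\ b| = beta by have := cardsD1 b B'; rewrite bB' cB'; arith.
  have := IH _ _ _ _ _ (bal' _) pq c1 c2; case; [arith|arith|arith|arith| |].
    by case; rewrite !in_setD1 => /andP[_ ->] /andP[_ ->]; left.
  case=> Eh [s [ps ss es Bs]]; right; split; first by arith.
  exists (b' :: s); rewrite /= ps ss; split=> //.
    by rewrite andbT; rewrite lvl1 inE in a'b'.
  move=> x; rewrite in_cons -Bs in_setD1; case: (altP (x =P b')) => [->|//].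
  by rewrite b'B.
Qed.

(** Both sides are the complement of [T K c] without [a] and [b], since [b] is in [O u] and [a] in
    [O v]. *)
Lemma sharing_balanced u v a c b : sharing u v a c b ->
  balanced K a b u v (O u :\ b) (O v :\ a).
Proof.
have half u0 v0 a0 b0 z : sharing u0 v0 a0 c b0 ->
    (z \in u0 |: (T' K a0 :|: (O u0 :\ b0)))
      = [&& z \notin T K c, z != a0 & z != b0].
  move=> sh; have [Nu _ _] := sh; have b0O := sharing_outlier sh.
  have [[ua uc vc vb] [ac cb ab uv]] := sharingE sh.
  rewrite [z \in u0 |: (T' K a0 :|: _)]in_setU1 [z \in T' K a0 :|: _]in_setU in_setD1.
  rewrite in_setC [z \in T K.+1 u0]in_setU1 (tree'2 _ _ Nu) [z \in T K a0]in_setU1.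
  case: (altP (z =P u0)) => [->|zu] /=.
    have -> : u0 \notin T K c.
      by apply/negP=> /treeP[s sK cu]; have := acyclic geo (lvlS uc cu); arith.
    have -> : u0 != a0.
      apply/eqP=> ua'; rewrite -ua' -lvl1 in ua.
      by have := acyclic geo ua; arith.
    apply/esym/eqP=> ub'; rewrite -ub' in b0O.
    by apply: (outlier_lvl (s := 0) b0O) => //=; rewrite inE.
  case: (boolP (z \in T' K a0)) => az /=.
    have zT : z \in T K a0 by rewrite in_setU1 az orbT.
    have -> : z \notin T K c.
      by apply/negP=> cz; apply: (tree_disj geo ua uc ac _ zT cz).
    have -> : z != a0.
      apply/eqP=> za; move/tree'P: az => [s [s0 sK]]; rewrite za => aa.
      by have := acyclic geo aa; arith.
    by apply/esym/eqP=> zb; rewrite zb in zT; apply: (tree_outlier ua zT).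
  by rewrite orbF; case: (z == a0); case: (z \in T K c); case: (z == b0).
move=> sh; have sh' := sharing_sym sh.
have bO := sharing_outlier sh; have aO := sharing_outlier sh'.
have [[ua uc vc vb] _] := sharingE sh.
have dj u0 a0 b0 : a0 \in N u0 -> [disjoint O u0 :\ b0 & T' K a0].
  move=> ua0; apply: disjointWl (subD1set _ _) _.
  rewrite disjoints_subset; apply/subsetP=> z zO; rewrite inE.
  apply/negP=> az; apply: (tree_outlier ua0 _ (leqnn K) zO).
  by rewrite in_setU1 az orbT.
have nt u0 a0 : a0 \in N u0 -> u0 \notin T' K a0.
  move=> ua0; apply/negP=> /tree'P[s [s0 sK au]].
  by have := acyclic geo (lvlS ua0 au); arith.
split; rewrite ?dj ?nt //.
- by apply/setP=> z; rewrite (half _ _ _ _ _ sh) (half _ _ _ _ _ sh') [(z != b) && _]andbC.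
- by move=> j; apply: lvl_sharing_far sh'.
- by move=> j; apply: lvl_sharing_far sh.
Qed.

Lemma sharing_dichotomy u v a c b : sharing u v a c b ->
  v \in O u /\ u \in O v \/ K = ep /\
  exists s, [/\ path e v (b :: s), size (b :: s) = ep, e (last b s) u & O u =i b :: s].
Proof.
move=> sh; have bO := sharing_outlier sh; have aO := sharing_outlier (sharing_sym sh).
have [[ua uc vc vb] [_ _ _ uv]] := sharingE sh.
have c1 : #|O u :\ b| = ep.-1 by have := cardsD1 b (O u); rewrite bO card_outliers; arith.
have c2 : #|O v :\ a| = ep.-1 by have := cardsD1 a (O v); rewrite aO card_outliers; arith.
have := descent (sharing_balanced sh) uv c1 c2; case; [arith|arith|arith| |].
  by rewrite !in_setD1 => -[/andP[_ ->] /andP[_ ->]]; left.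
case=> EK [s [ps ss es Bs]]; right; split; first by arith.
exists s; split=> //=; first by rewrite ps andbT; rewrite inE in vb.
  by rewrite ss; arith.
move=> x; rewrite in_cons -Bs in_setD1; case: (altP (x =P b)) => [->|//].
by rewrite bO.
Qed.

(* [a' = b] would give three pairwise disjoint trees of depth [K]: too many vertices. *)
Lemma sharing_extend u v a c b : sharing u v a c b ->
  exists v' a', sharing v' u a' a c /\ a' != b.
Proof.
move=> sh; have [[ua uc vc vb] [ac cb ab uv]] := sharingE sh; have [Nu Nv _] := sh.
have ua' : u \in [set y | e y a] by rewrite !inE in ua *.
have : #|[set y | e y a] :\ u| = 1.
  by have := cardsD1 u [set y | e y a]; rewrite ua' ideg; arith.
move/eqP/cards1P=> [v' Ev'].
have : v' \in [set v'] by rewrite inE.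
rewrite -Ev' in_setD1 inE => /andP[v'u ev'a].
have v'a : a \in N v' by rewrite inE.
have v'v : v' != v.
  by apply/eqP=> E; rewrite E Nv !inE (negbTE ac) (negbTE ab) in v'a.
have [a' Nv' a'a] := out_other deg v'a.
have a'c : a' != c.
  (* Otherwise [c] would have three in-neighbours. *)
  apply/eqP=> E; have : [set u; v; v'] \subset [set y | e y c].
    have : c \in N v' by rewrite Nv' E !inE eqxx.
    by move: uc vc; rewrite !inE => euc evc ev'c; apply/subsetP=> y; rewrite !inE
      => /orP[/orP[]|]/eqP->.
  move/subset_leq_card; rewrite ideg setUC cardsU1 cards2 uv !inE.
  by rewrite (negbTE v'u) (negbTE v'v).
exists v', a'; split; first by split.
apply/eqP=> E.
have dj x y y' : y \in N x -> y' \in N x -> y != y' -> T K y :&: T K y' = set0.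
  move=> xy xy' yy'; apply/setP=> z; rewrite in_setI in_set0; apply/negP=> /andP[yz y'z].
  exact: (tree_disj geo xy xy' yy' (ltnSn K) yz y'z).
have v'b : b \in N v' by rewrite Nv' E !inE eqxx.
have := subset_leq_card (subsetT (T K a :|: T K c :|: T K b)).
rewrite cardsU setIUl (dj _ _ _ v'a v'b ab) (dj _ _ _ vc vb cb) setU0 cards0 subn0.
rewrite cardsU (dj _ _ _ ua uc ac) cards0 subn0 cardsT.
have ct := card_tree geo deg _ (leqnSn K).
have := ct a; have := ct b; have := ct c; move: cardV; rewrite !expnS.
(* The three trees have [3 * (2 ^ K.+1 - 1)] vertices, so [2 ^ K.+1 <= ep + 2], which fails for
   [ep <= K]. *)
have : 2 ^ ep <= 2 ^ K by rewrite leq_exp2l.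
have : 2 + ep < 2 * 2 ^ ep by case: (ep) ep2 ep3 => [|[|[|[|?]]]].
have : 0 < 2 ^ ep by rewrite expn_gt0.
by arith.
Qed.

Lemma path_rank x s u y : path e x s -> e (last x s) u -> y \in s ->
  u \in L (size s - index y s) y.
Proof.
elim: s x => // b s IH x /= /andP[xb bs] su.
rewrite in_cons; case: (altP (b =P y)) => [<- _|by_].
  rewrite subn0; apply/lvlP; exists (rcons s u); last by rewrite size_rcons.
  by rewrite /dpath rcons_path bs su last_rcons eqxx.
by rewrite eq_sym (negbTE by_) /= subSS; apply: IH bs su.
Qed.

(** Suppose [O u] is a path from [b] leading to [u]. If [v'] is on it, [v'] reaches [a] through [u]
    besides its own arc to [a]. Otherwise [O u] is also a path from [a'] leading to [u], and
    [a' != b] gives [a'] two distances to [u]. *)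
Lemma sharing_mutual u v a c b : sharing u v a c b -> v \in O u.
Proof.
move=> sh; case: (sharing_dichotomy sh) => [[]//|[EK [s [ps ss es Os]]]].
have [v' [a' [sh' a'b]]] := sharing_extend sh.
have [[v'a' v'a _ _] _] := sharingE sh'.
have sb : forall y, y \in O u -> u \in L (ep - index y (b :: s)) y.
  by move=> y; rewrite Os => ys; rewrite -ss; apply: path_rank ps es ys.
case: (sharing_dichotomy (sharing_sym sh')) => [[v'O _]|[_ [s' [ps' ss' es' Os']]]].
  have [[ua _ _ _] _] := sharingE sh.
  have il : index v' (b :: s) < ep by rewrite -ss index_mem -Os.
  rewrite -lvl1 in v'a.
  by have := lvl_inj geo v'a (lvlSr (sb _ v'O) ua); arith.
have a'O : a' \in O u by rewrite Os' mem_head.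
have := path_rank ps' es' (mem_head a' s'); rewrite ss' /= eqxx subn0 => a'u.
have := lvl_inj geo a'u (sb _ a'O) => /=; rewrite eq_sym (negbTE a'b).
by arith.
Qed.

(** [O u] contains [v], [b], [v'] and [a'], among which only [v = a'] and [v' = b] are possible
    coincidences; both together would close a 2-cycle. *)
Lemma sharing_meet v' u v a' a c b : sharing v' u a' a c -> sharing u v a c b ->
  a' != b -> ep = 3 /\ (v = a' \/ v' = b).
Proof.
move=> sh' sh a'b.
have [[v'a' v'a _ _] [a'a _ a'c v'u]] := sharingE sh'.
have [[ua uc vc vb] [ac cb ab uv]] := sharingE sh; have [_ Nv _] := sh.
have loop x : x \notin N x.
  by apply/negP; rewrite -lvl1 => xx; have := acyclic geo xx; arith.
have v'v : v' != v.
  by apply/eqP=> E; rewrite E Nv !inE (negbTE ac) (negbTE ab) in v'a.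
have sO : [set v; b] :|: [set v'; a'] \subset O u.
  rewrite !subUset !sub1set (sharing_outlier sh) (sharing_mutual sh).
  by rewrite (sharing_outlier (sharing_sym sh')) (sharing_mutual (sharing_sym sh')).
have vb' : v != b by apply/eqP=> E; have := loop b; rewrite -{2}E vb.
have v'a'' : v' != a' by apply/eqP=> E; have := loop a'; rewrite -{2}E v'a'.
have := subset_leq_card sO; rewrite card_outliers.
case: (altP (v =P a')) => va'; case: (altP (v' =P b)) => v'b.
- rewrite -va' in v'a'; rewrite -v'b in vb.
  by have := acyclic geo (lvl2 v'a' vb); arith.
- have : #|[set v; b; v']| = 3.
    by rewrite setUC cardsU1 cards2 vb' !inE (negbTE v'v) (negbTE v'b).
  have : #|[set v; b; v']| <= #|[set v; b] :|: [set v'; a']|.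
    by apply: subset_leq_card; rewrite setUSS //; apply: subsetUl.
  by split; [arith|left].
- have : #|[set v; b; a']| = 3.
    by rewrite setUC cardsU1 cards2 vb' !inE eq_sym (negbTE va') (negbTE a'b).
  have : #|[set v; b; a']| <= #|[set v; b] :|: [set v'; a']|.
    by apply: subset_leq_card; rewrite setUSS //; apply: subsetUr.
  by split; [arith|right].
- rewrite cardsU !cards2 vb' v'a''.
  have -> : [set v; b] :&: [set v'; a'] = set0.
    apply/setP=> z; rewrite !inE; apply/negP=> /andP[/orP[]/eqP->].
      by rewrite eq_sym (negbTE v'v) (negbTE va').
    by rewrite ![b == _]eq_sym (negbTE v'b) (negbTE a'b).
  by rewrite cards0; arith.
Qed.

(** The other alternative of [sharing_meet], [v'' = c], would close a 2-cycle with [v = a']. *)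
Lemma sharing_shift v' u v a' a c b : sharing v' u a' a c -> sharing u v a c b ->
  a' != b -> v = a' ->
  exists v'' a'', [/\ sharing v'' v' a'' a' a, a'' != c & u = a''].
Proof.
move=> sh' sh a'b va'.
have [v'' [a'' [sh'' a''c]]] := sharing_extend sh'.
exists v'', a''; split=> //.
have [_ [//|v''c]] := sharing_meet sh'' sh' a''c.
have [[_ v''a' _ _] _] := sharingE sh''; have [[_ _ vc _] _] := sharingE sh.
rewrite va' -v''c in vc; by have := acyclic geo (lvl2 v''a' vc); arith.
Qed.

(** Two shifts produce [v3] with out-neighbours [u] and [v']; it reaches [c] through [u] in two
    steps and through [v'] and [v] in three. *)
Lemma no_rotation v' u v a' a c b : sharing v' u a' a c -> sharing u v a c b ->
  a' != b -> v = a' -> ep = 3 -> False.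
Proof.
move=> sh1 sh0 ab1 E1 ep_eq.
have [v2 [a2 [sh2 ab2 E2]]] := sharing_shift sh1 sh0 ab1 E1.
have [v3 [a3 [sh3 ab3 E3]]] := sharing_shift sh2 sh1 ab2 E2.
have [[v3a3 v3a2 _ _] _] := sharingE sh3.
have [[ua uc vc _] _] := sharingE sh0; have [[v'a' _ _ _] _] := sharingE sh1.
rewrite -E3 in v3a3; rewrite -E2 in v3a2; rewrite -E1 in v'a'.
have := lvl_inj geo (lvl2 v3a2 uc) (lvlS v3a3 (lvl2 v'a' vc)).
by arith.
Qed.

Lemma no_sharing u v a c b : ~ sharing u v a c b.
Proof.
move=> sh; have [v' [a' [sh' a'b]]] := sharing_extend sh.
have [ep_eq [va'|v'b]] := sharing_meet sh' sh a'b.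
  exact: no_rotation sh' sh a'b va' ep_eq.
(* The case [v' = b] is the previous one read from the other end. *)
apply: (no_rotation (sharing_sym sh) (sharing_sym sh')) => //; by rewrite eq_sym.
Qed.

Lemma out_eq u v x : x \in N u -> x \in N v -> N u = N v.
Proof.
move=> ux vx; have [a Nu ax] := out_other deg ux; have [b Nv bx] := out_other deg vx.
case: (altP (a =P b)) => [ab|ab]; first by rewrite Nu Nv ab.
by case: (@no_sharing u v a x b); split=> //; rewrite setUC.
Qed.

End Excess.

(** * The root of a line digraph *)

Section LineRoot.
Variables (V : finType) (e : rel V) (k : nat).
Hypothesis geo : k_geodetic e k.+1.
Hypothesis k0 : 0 < k.
Hypothesis deg : forall x, #|out e x| = 2.
Hypothesis ideg : forall x, #|[set y | e y x]| = 2.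
Hypothesis twins : forall u v x, x \in out e u -> x \in out e v -> out e u = out e v.
Notation N := (out e).

(* If any two vertices with a common out-neighbour have the same out-neighbours,
   the digraph is a line digraph; the vertices of its root are the sets [N u]. *)
Definition line_root : finType := {A : {set V} | A \in [set N u | u : V]}.
Definition root_arc : rel line_root :=
  fun A B => [exists x in val A, N x == val B].

Lemma line_rootP (A : line_root) : exists u, val A = N u.
Proof. by have /imsetP[u _ ->] := valP A; exists u. Qed.

(** The twins of [u] are the in-neighbours of any out-neighbour of [u]. *)
Lemma card_twins u : #|[set v | N v == N u]| = 2.
Proof.
have [x [y [Nu _]]] := out2 deg u.
have ux : x \in N u by rewrite Nu !inE eqxx.
rewrite -(ideg x); apply: eq_card => v; rewrite !inE.
apply/eqP/idP => [E|vx]; first by rewrite -E inE in ux.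
by apply: (twins (x := x)) => //; rewrite inE.
Qed.

Lemma siblings_inj u : {in N u &, injective N}.
Proof.
move=> x y ux uy E; have [z [t [Nx _]]] := out2 deg x.
have xz : z \in N x by rewrite Nx !inE eqxx.
have yz : z \in N y by rewrite -E.
rewrite -!lvl1 in ux uy xz yz; apply: (lvl_mid geo ux uy xz yz); lia.
Qed.

Lemma card_line_root : #|V| = 2 * #|line_root|.
Proof.
rewrite card_sig -sum1_card (partition_big_imset N) /=.
rewrite mulnC -sum_nat_const; apply: eq_big => [A|A /imsetP[u _ ->]].
  by rewrite inE.
by rewrite sum1_card -(card_twins u); apply: eq_card => v; rewrite !inE.
Qed.

Lemma card_root_out A : #|[set B | root_arc A B]| = 2.
Proof.
have [u Au] := line_rootP A.
rewrite -(card_imset _ val_inj) -(deg u) -(card_in_imset (@siblings_inj u)).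
apply: eq_card => C; apply/imsetP/imsetP => [[B]|[x ux ->]].
  rewrite inE => /exists_inP[x]; rewrite Au => ux /eqP <- ->; by exists x.
have Nx : N x \in [set N u | u : V] by apply: imset_f.
exists (exist _ (N x) Nx) => //; rewrite inE; apply/exists_inP; exists x => //.
by rewrite Au.
Qed.

Lemma card_root_in B : #|[set A | root_arc A B]| = 2.
Proof.
have [w Bw] := line_rootP B.
(* The out-set of an in-neighbour of [x], independent of the choice by [twins]; the default never
   occurs, since in-degrees are positive. *)
pose g x := N (odflt x [pick u | e u x]).
have gE u x : e u x -> g x = N u.
  rewrite /g; case: pickP => [v vx|/(_ u)->//] ux.
  by apply: (twins (x := x)); rewrite inE.
have pred x : exists u, e u x.
  have /card_gt0P[u] : 0 < #|[set y | e y x]| by rewrite ideg.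
  by rewrite inE; exists u.
rewrite -(card_imset _ val_inj) -(card_twins w) -(card_in_imset (f := g)).
  apply: eq_card => C; apply/imsetP/imsetP => [[A]|[x]].
    rewrite inE => /exists_inP[x Ax /eqP Nx] ->.
    exists x; first by rewrite inE Nx Bw.
    have [u Au] := line_rootP A; rewrite Au; apply/esym/gE.
    by rewrite Au inE in Ax.
  rewrite inE => /eqP Nx ->; have [u ux] := pred x.
  have Nu : N u \in [set N u | u : V] by apply: imset_f.
  exists (exist _ (N u) Nu); last by rewrite (gE _ _ ux).
  by rewrite inE; apply/exists_inP; exists x; rewrite /= ?inE ?Nx ?Bw.
move=> x y; rewrite !inE => /eqP Nx /eqP Ny gxy.
have [u ux] := pred x; have [v vy] := pred y.
rewrite (gE _ _ ux) (gE _ _ vy) in gxy.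
by apply: (@siblings_inj u); [rewrite inE|rewrite gxy inE|rewrite Nx Ny].
Qed.

Lemma root_path_lift (p : seq line_root) A u : N u = val A -> path root_arc A p ->
  exists2 p', path e u p' & map N p' = map val p.
Proof.
elim: p A u => [|B p IH] A u EA /=; first by exists [::].
case/andP=> /exists_inP[x Ax /eqP Nx] /(IH _ _ Nx)[p' xp' Ep'].
exists (x :: p'); rewrite /= ?Nx ?Ep' // xp' andbT.
by rewrite -EA inE in Ax.
Qed.

(** Root paths lift to paths of the same length from [u], and one more arc takes each to the same
    [y] in [val B]; that arc accounts for the loss from [k.+1] to [k]. *)
Lemma root_geodetic : k_geodetic root_arc k.
Proof.
move=> A B p q /andP[Ap /eqP lp] sp /andP[Aq /eqP lq] sq.
have [u Au] := line_rootP A; have [w Bw] := line_rootP B.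
have [y [t [Nw _]]] := out2 deg w.
have wy : y \in N w by rewrite Nw !inE eqxx.
have ext r : path root_arc A r -> last A r = B -> size r <= k ->
    exists r', [/\ dpath e u y (rcons r' y), size (rcons r' y) <= k.+1 & map N r' = map val r].
  move=> Ar lr sr; have [r' ur' Er'] := root_path_lift (esym Au) Ar.
  exists r'; split=> //; last by rewrite size_rcons -(size_map N) Er' size_map.
  rewrite /dpath last_rcons eqxx andbT rcons_path ur' /=.
  have : N (last u r') = N w.
    by rewrite -(last_map N) Er' -Au last_map lr.
  by move=> E; move: wy; rewrite -E inE.
have [p' [dp sp' Ep]] := ext _ Ap lp sp; have [q' [dq sq' Eq]] := ext _ Aq lq sq.
have /eqP := geo dp sp' dq sq'; rewrite eqseq_rcons => /andP[/eqP E _].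
by apply: (inj_map val_inj); rewrite -Ep -Eq E.
Qed.

End LineRoot.

(** * Excess 2, excess 3 and the theorem *)

Lemma no_excess2 (V : finType) (e : rel V) (K : nat) : 2 <= K ->
  k_geodetic e K.+1 -> (forall x, #|out e x| = 2) ->
  (forall x, #|[set y | e y x]| = 2) -> #|V|.+1 <> 2 ^ K.+2 + 2.
Proof.
move=> K2 geo deg ideg cV.
have := card_line_root deg ideg (out_eq geo deg ideg cV (ltnSn 1) (leqnSn 2) K2).
by move: cV; rewrite expnS; lia.
Qed.

Lemma no_excess3 (V : finType) (e : rel V) (K : nat) : 3 <= K ->
  k_geodetic e K.+1 -> (forall x, #|out e x| = 2) ->
  (forall x, #|[set y | e y x]| = 2) -> #|V|.+1 <> 2 ^ K.+2 + 3.
Proof.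
case: K => // K K2 geo deg ideg cV.
have twins := out_eq geo deg ideg cV isT (leqnn 3) K2.
apply: (no_excess2 (V := line_root e) K2 (root_geodetic geo deg)).
- exact: (card_root_out geo).
- exact: (card_root_in geo).
(* Halving the order [2 ^ K.+3 + 2] gives [2 ^ K.+2 + 1], which is excess 2 at geodecity [K.+1]. *)
have := card_line_root deg ideg twins.
by move: cV; rewrite [2 ^ K.+3]expnS; lia.
Qed.

Lemma mooreE k : (moore 2 k).+1 = 2 ^ k.+1.
Proof.
elim: k => [|k IH]; first by rewrite /moore big_nat1.
by rewrite /moore big_nat_recr //= -addSn IH [2 ^ k.+2]expnS; lia.
Qed.

Theorem theorem4 (k : nat) : 4 <= k ->
  ~ (exists (V : finType) (e : rel V),
       [/\ diregular e 2, #|V| = moore 2 k + 3 & k_geodetic e k]).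
Proof.
case: k => // k k3 [V [e [reg cV geo]]].
apply: (no_excess3 k3 geo) => [x|x|]; [by case: (reg x)|by case: (reg x)|].
by rewrite cV -addSn mooreE.
Qed.
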